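(* For every single-qubit state (density matrix) $\rho$, $$\Lambda^+(\rho)=\Lambda(\rho)=\Xi(\rho),$$ and furthermore $\rho$ admits an equimagical decomposition.
   Context: $\mathrm{S}_n$ denotes the set of pure $n$-qubit stabilizer states (states $|\psi\rangle$ for which there is an abelian subgroup of the $n$-qubit Pauli group with $2^n$ elements all of which fix $|\psi\rangle$); for $n=1$ these are $|0\rangle,|1\rangle,|\pm\rangle,|\pm_i\rangle$. $\bar{\mathrm S}_n=\mathrm{conv}\{|\phi\rangle\langle\phi|:|\phi\rangle\in\mathrm S_n\}$ is the set of mixed stabilizer states. The stabilizer extent of a pure state is $\xi(\Psi)=\min\{\|c\|_1^2: |\Psi\rangle=\sum_j c_j|\phi_j\rangle,\ |\phi_j\rangle\in\mathrm S_n\}$. The mixed-state extent is $\Xi(\rho)=\min\{\sum_j p_j\xi(\Psi_j):\rho=\sum_jp_j|\Psi_j\rangle\langle\Psi_j|\}$, minimum over convex decompositions into pure states; if the minimum is attained by a decomposition in which all $\xi(\Psi_j)$ are equal, $\rho$ is said to admit an equimagical decomposition. The dyadic negativity is $\Lambda(\rho)=\min\{\|\alpha\|_1:\rho=\sum_j\alpha_j|L_j\rangle\langle R_j|,\ |L_j\rangle,|R_j\rangle\in\mathrm S_n,\ \alpha_j\in\mathbb C\}$. The generalized robustness is $\Lambda^+(\rho)=\min\{\lambda:\rho\le\lambda\sigma,\ \sigma\in\bar{\mathrm S}_n\}$, equivalently $\max\{\mathrm{Tr}[W\rho]:W\ge0,\ \langle\phi|W|\phi\rangle\le1\ \forall|\phi\rangle\in\mathrm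 S_n\}$. *)

(* Defs.v *)
From HB Require Import structures.
From mathcomp Require Import all_boot all_order all_algebra.
From mathcomp Require Import complex.
From mathcomp Require Import classical_sets reals.

Set Implicit Arguments.
Unset Strict Implicit.
Unset Printing Implicit Defensive.

Import Order.TTheory GRing.Theory Num.Theory.
Local Open Scope ring_scope.
Local Open Scope classical_set_scope.
Local Open Scope complex_scope.

Section SingleQubit.
Variable R : realType.
Local Notation C := R[i].
Definition iC : C := Complex 0 1.

Definition absC (z : C) : R := complex.Re `|z|.

Definition dag m n (A : 'M[C]_(m, n)) : 'M[C]_(n, m) := (map_mx conjc A)^T.

Definition psd (A : 'M[C]_2) : Prop :=
  dag A = A /\ forall v : 'cV[C]_2, 0 <= (dag v *m A *m v) 0 0.

Definition density (rho : 'M[C]_2) : Prop := psd rho /\ \tr rho = 1.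

Definition unit_vec (psi : 'cV[C]_2) : Prop := (dag psi *m psi) 0 0 = 1.

Definition ket_bra (psi phi : 'cV[C]_2) : 'M[C]_2 := psi *m dag phi.
Definition proj (psi : 'cV[C]_2) : 'M[C]_2 := ket_bra psi psi.

Definition pauliX : 'M[C]_2 := delta_mx 0 1 + delta_mx 1 0.
Definition pauliY : 'M[C]_2 := (- iC) *: delta_mx 0 1 + iC *: delta_mx 1 0.
Definition pauliZ : 'M[C]_2 := delta_mx 0 0 - delta_mx 1 1.

Definition pauli_group1 (P : 'M[C]_2) : Prop :=
  exists (k : nat) (Q : 'M[C]_2),
    Q \in [:: 1%:M; pauliX; pauliY; pauliZ] /\ P = (iC ^+ k) *: Q.

(* S_1 : pure 1-qubit stabilizer states: normalized psi fixed by every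
   element of an abelian subgroup G = {P1, P2} (2^1 = 2 elements) of the
   Pauli group. *)
Definition stab_state (psi : 'cV[C]_2) : Prop :=
  unit_vec psi /\
  exists P1 P2 : 'M[C]_2,
    [/\ pauli_group1 P1 /\ pauli_group1 P2, P1 != P2,
        (* G = [:: P1; P2] is a subgroup: closed under products
           (a finite nonempty multiplicatively closed subset of a group) *)
        (forall A B, A \in [:: P1; P2] -> B \in [:: P1; P2] ->
            A *m B \in [:: P1; P2]),
        P1 *m P2 = P2 *m P1 &
        P1 *m psi = psi /\ P2 *m psi = psi].

Definition mixed_stab (sigma : 'M[C]_2) : Prop :=
  exists (k : nat) (p : 'I_k -> R) (phi : 'I_k -> 'cV[C]_2),
    [/\ forall j, 0 <= p j, \sum_(j < k) p j = 1,
        forall j, stab_state (phi j) &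
        sigma = \sum_(j < k) (p j)%:C *: proj (phi j)].

Definition extent (Psi : 'cV[C]_2) : R :=
  inf [set r : R | exists (k : nat) (c : 'I_k -> C) (phi : 'I_k -> 'cV[C]_2),
    [/\ forall j, stab_state (phi j),
        Psi = \sum_(j < k) c j *: phi j &
        r = (\sum_(j < k) absC (c j)) ^+ 2]].

Definition pure_decomp (rho : 'M[C]_2) (k : nat) (p : 'I_k -> R)
    (Psi : 'I_k -> 'cV[C]_2) : Prop :=
  [/\ forall j, 0 <= p j, \sum_(j < k) p j = 1,
      forall j, unit_vec (Psi j) &
      rho = \sum_(j < k) (p j)%:C *: proj (Psi j)].

Definition mixed_extent (rho : 'M[C]_2) : R :=
  inf [set r : R | exists (k : nat) (p : 'I_k -> R) (Psi : 'I_k -> 'cV[C]_2),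
    pure_decomp rho p Psi /\ r = \sum_(j < k) p j * extent (Psi j)].

Definition equimagical (rho : 'M[C]_2) : Prop :=
  exists (k : nat) (p : 'I_k -> R) (Psi : 'I_k -> 'cV[C]_2),
    [/\ pure_decomp rho p Psi,
        forall i j, extent (Psi i) = extent (Psi j) &
        \sum_(j < k) p j * extent (Psi j) = mixed_extent rho].

Definition dyadic_negativity (rho : 'M[C]_2) : R :=
  inf [set r : R | exists (k : nat) (a : 'I_k -> C) (L Rv : 'I_k -> 'cV[C]_2),
    [/\ forall j, stab_state (L j), forall j, stab_state (Rv j),
        rho = \sum_(j < k) a j *: ket_bra (L j) (Rv j) &
        r = \sum_(j < k) absC (a j)]].

Definition gen_robustness (rho : 'M[C]_2) : R :=
  inf [set l : R | exists sigma, mixed_stab sigma /\ psd (l%:C *: sigma - rho)].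

End SingleQubit.

(* Main.v *)
(** Identify single-qubit operators with pairs (trace, Bloch vector).  A number
    [l] is feasible for the generalized robustness of [rho] iff
    [rho <= l sigma] for some [sigma] in the stabilizer octahedron, i.e. iff the
    Bloch vector [n] satisfies [|s - n|_2 <= l - 1] for some [s] with
    [|s|_1 <= l]; by compactness a least such [l] exists.

    Lower bounds: [a |L><R| + h.c. <= |a| (|L><L| + |R><R|)] makes the cost of
    any dyadic decomposition feasible.  In particular the extent of a pure state
    is feasible for it, and feasibility is jointly convex, so the cost of any
    pure decomposition is feasible too.

    Upper bounds: put [d = n - s], so [|d|_2 <= l - 1].  The vertices
    [l e_j + d] of the shifted octahedron [{a : |a - d|_1 <= l}] have norm at
    least 1, hence [n] is a convex combination of unit vectors of that
    octahedron.  These are pure states for which [l] is still feasible.  For a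
    pure state, feasibility of [l] yields a stabilizer superposition of squared
    l1 norm at most [l], so all these pure states have extent at most [l], and
    expanding them gives a dyadic decomposition of cost at most [l]. *)
Require Import Defs.
From HB Require Import structures.
From mathcomp Require Import all_boot all_order all_algebra.
From mathcomp Require Import complex.
From mathcomp Require Import boolp classical_sets reals.
From mathcomp Require Import topology normedtype realfun derive.
From mathcomp Require Import ring lra.

Set Implicit Arguments.
Unset Strict Implicit.
Unset Printing Implicit Defensive.

Import Order.TTheory GRing.Theory Num.Theory.
Import numFieldNormedType.Exports.
Local Open Scope ring_scope.
Local Open Scope classical_set_scope.
Local Open Scope complex_scope.

(** * Hermitian forms and positive semidefinite matrices of size two *)

Section HermitianForms.
Variable R : realType.
Local Notation C := R[i].

Definition braket (u v : 'cV[C]_2) : C := (dag u *m v) 0 0.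

Definition qform (A : 'M[C]_2) (v : 'cV[C]_2) : C := (dag v *m A *m v) 0 0.

Lemma conjcR (r : R) : conjc (r%:C : C) = r%:C.
Proof. exact: conjc_real. Qed.

Lemma absCE (z : C) : (absC z)%:C = `|z|.
Proof. by rewrite /absC normc_def. Qed.

Lemma absC_ge0 (z : C) : 0 <= absC z.
Proof. by rewrite -ler0c absCE. Qed.

Lemma absCM (z t : C) : absC (z * t) = absC z * absC t.
Proof. by apply: complexI; rewrite rmorphM /= !absCE normrM. Qed.

Lemma absCJ (z : C) : absC (conjc z) = absC z.
Proof. by apply: complexI; rewrite !absCE normcJ. Qed.

Lemma absC_real (r : R) : 0 <= r -> absC r%:C = r.
Proof. by move=> r0; apply: complexI; rewrite absCE ger0_norm ?ler0c. Qed.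

Lemma mulcJE (z : C) : z * conjc z = (absC z ^+ 2)%:C.
Proof. by rewrite rmorphXn /= absCE sqr_normc. Qed.

Lemma Re_le_absC (z : C) : complex.Re z <= absC z.
Proof.
rewrite -lecR absCE; apply: le_trans (normc_ge_Re z).
by rewrite lecR ler_norm.
Qed.

Lemma dagD m n (A B : 'M[C]_(m, n)) : dag (A + B) = dag A + dag B.
Proof. by rewrite /dag map_mxD linearD. Qed.

Lemma dagN m n (A : 'M[C]_(m, n)) : dag (- A) = - dag A.
Proof. by rewrite /dag map_mxN linearN. Qed.

Lemma dagZ m n (c : C) (A : 'M[C]_(m, n)) : dag (c *: A) = conjc c *: dag A.
Proof. by rewrite /dag map_mxZ linearZ. Qed.

Lemma dag0 m n : dag (0 : 'M[C]_(m, n)) = 0.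
Proof. by rewrite /dag map_mx0 linear0. Qed.

Lemma dag_sum m n (I : finType) (F : I -> 'M[C]_(m, n)) :
  dag (\sum_i F i) = \sum_i dag (F i).
Proof. by rewrite (big_morph (@dag R m n) (@dagD m n) (dag0 m n)). Qed.

Lemma dagM m n p (A : 'M[C]_(m, n)) (B : 'M_(n, p)) :
  dag (A *m B) = dag B *m dag A.
Proof. by rewrite /dag map_mxM trmx_mul. Qed.

Lemma dagK m n (A : 'M[C]_(m, n)) : dag (dag A) = A.
Proof. by apply/matrixP => i j; rewrite !mxE conjcK. Qed.

Lemma dag_ket_bra (u v : 'cV[C]_2) : dag (ket_bra u v) = ket_bra v u.
Proof. by rewrite /ket_bra dagM dagK. Qed.

Lemma braketJ (u v : 'cV[C]_2) : conjc (braket u v) = braket v u.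
Proof.
have -> : conjc (braket u v) = dag (dag u *m v) 0 0 by rewrite [RHS]mxE [RHS]mxE.
by rewrite dagM dagK.
Qed.

Lemma qformD (A B : 'M[C]_2) v : qform (A + B) v = qform A v + qform B v.
Proof. by rewrite /qform mulmxDr mulmxDl mxE. Qed.

Lemma qformZ (c : C) (A : 'M[C]_2) v : qform (c *: A) v = c * qform A v.
Proof. by rewrite /qform -scalemxAr -scalemxAl mxE. Qed.

Lemma qformN (A : 'M[C]_2) v : qform (- A) v = - qform A v.
Proof. by rewrite -scaleN1r qformZ mulN1r. Qed.

Lemma qform_sum (I : finType) (F : I -> 'M[C]_2) v :
  qform (\sum_i F i) v = \sum_i qform (F i) v.
Proof.
rewrite (big_morph (fun A => qform A v) (id1 := 0) (op1 := +%R)) //.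
  by move=> A B; exact: qformD.
by rewrite -[in LHS](scale0r (1%:M)) qformZ mul0r.
Qed.

Lemma qform_ket_bra (L Rv v : 'cV[C]_2) :
  qform (ket_bra L Rv) v = braket v L * braket Rv v.
Proof.
rewrite /qform /ket_bra /braket mulmxA -mulmxA [LHS]mxE big_ord_recl big_ord0.
by rewrite addr0.
Qed.

Lemma qform_proj (u v : 'cV[C]_2) :
  qform (proj u) v = (absC (braket u v) ^+ 2)%:C.
Proof. by rewrite qform_ket_bra -mulcJE -(braketJ u v) mulrC. Qed.

Lemma psd0 : psd (0 : 'M[C]_2).
Proof.
split=> [|v]; first exact: dag0.
by rewrite -/(qform _ _) -(scale0r (1%:M)) qformZ mul0r.
Qed.

Lemma psdD (A B : 'M[C]_2) : psd A -> psd B -> psd (A + B).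
Proof.
move=> [hA pA] [hB pB]; split=> [|v]; first by rewrite dagD hA hB.
by rewrite -/(qform _ _) qformD addr_ge0 ?pA ?pB.
Qed.

Lemma psdZ (r : R) (A : 'M[C]_2) : 0 <= r -> psd A -> psd (r%:C *: A).
Proof.
move=> r0 [hA pA]; split=> [|v]; first by rewrite dagZ hA conjcR.
by rewrite -/(qform _ _) qformZ mulr_ge0 ?ler0c ?pA.
Qed.

Lemma psd_sum (I : finType) (F : I -> 'M[C]_2) :
  (forall i, psd (F i)) -> psd (\sum_i F i).
Proof. move=> h; elim: (index_enum I) => [|i r IH]; first by rewrite big_nil;
  exact: psd0.
by rewrite big_cons; apply: psdD. Qed.

Lemma psd_proj (u : 'cV[C]_2) : psd (proj u).
Proof.
split=> [|v]; first by rewrite dag_ket_bra.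
by rewrite -/(qform _ _) qform_proj ler0c sqr_ge0.
Qed.

(** With [l = <L|v>] and [r = <Rv|v>], the two cross terms are conjugate and add up to twice the
    real part of [a conj(l) r]. The form at [v] is therefore at least [|a| (|l| - |r|)^2]. *)
Lemma psd_dyad (a : C) (L Rv : 'cV[C]_2) :
  psd ((absC a)%:C *: (proj L + proj Rv)
       - (a *: ket_bra L Rv + conjc a *: ket_bra Rv L)).
Proof.
split=> [|v].
  rewrite dagD dagN !dagD !dagZ dagD !dag_ket_bra conjcK conjcR.
  by congr (_ - _); rewrite addrC.
rewrite -/(qform _ _) qformD qformN qformD !qformZ qformD !qform_proj.
rewrite !qform_ket_bra.
set l := braket L v; set r := braket Rv v.
have -> : braket v L = conjc l by rewrite braketJ.
have -> : braket v Rv = conjc r by rewrite braketJ.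
have -> : conjc a * (conjc r * l) = conjc (a * (conjc l * r)).
  by rewrite !rmorphM /= conjcK [l * _]mulrC.
rewrite addcJ -rmorphD -rmorphM.
have -> : (2%:R : C) = (2%:R : R)%:C by rewrite rmorph_nat.
rewrite -rmorphM -rmorphB ler0c subr_ge0.
have h := Re_le_absC (a * (conjc l * r)).
rewrite !absCM absCJ in h.
have := absC_ge0 a; move: h.
move: (complex.Re _) (absC a) (absC l) (absC r) => e x y z h x0.
have : 0 <= x * (y - z) ^+ 2 by rewrite mulr_ge0 ?sqr_ge0.
have -> : x * (y - z) ^+ 2 = x * (y ^+ 2 + z ^+ 2) - 2 * (x * (y * z)) by ring.
lra.
Qed.

(** A variance argument: the sum of [q i * (Q * x i - X) ^+ 2] equals [Q * (Q * Y - X ^+ 2)], and a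
    positive [Q] can be cancelled. If [Q = 0], every weight vanishes. *)
Lemma weighted_cauchy (I : finType) (q x : I -> R) :
  (forall i, 0 <= q i) ->
  (\sum_i q i * x i) ^+ 2 <= (\sum_i q i) * (\sum_i q i * x i ^+ 2).
Proof.
move=> q0; set X := \sum_i q i * x i; set Q := \sum_i q i.
set Y := \sum_i _.
have [Q0|Qn0] := eqVneq Q 0.
  have qe i : q i = 0.
    by apply/eqP; move/eqP: Q0; rewrite psumr_eq0 // => /allP; apply;
      rewrite mem_index_enum.
  by rewrite Q0 mul0r /X big1 ?expr0n // => i _; rewrite qe mul0r.
have Qp : 0 < Q by rewrite lt_def Qn0 sumr_ge0.
have h : 0 <= \sum_i q i * (Q * x i - X) ^+ 2.
  by apply: sumr_ge0 => i _; rewrite mulr_ge0 ?sqr_ge0.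
have e : \sum_i q i * (Q * x i - X) ^+ 2 = Q * (Q * Y - X ^+ 2).
  transitivity (\sum_i (Q ^+ 2 * (q i * x i ^+ 2) - 2 * Q * X * (q i * x i)
                        + X ^+ 2 * q i)).
    by apply: eq_bigr => i _; ring.
  rewrite big_split sumrB /= -!mulr_sumr -/X -/Y -/Q.
  by ring.
by move: h; rewrite e pmulr_rge0 // subr_ge0.
Qed.

End HermitianForms.

(** * Bloch coordinates of Hermitian matrices *)

Section Bloch.
Variable R : realType.
Local Notation C := R[i].
Local Notation vec := 'rV[R]_3.

Definition sqn (n : vec) : R := \sum_i n 0 i ^+ 2.
Definition l1 (n : vec) : R := \sum_i `|n 0 i|.

(* (w + n . sigma) / 2, with trace w; density matrices have w = 1. *)
Definition bloch (w : R) (n : vec) : 'M[C]_2 :=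
  \matrix_(i, j)
   (if (i == 0) && (j == 0) then ((w + n 0 2%R) / 2)%:C
    else if (i == 0) then Complex (n 0 0 / 2) (- (n 0 1 / 2))
    else if (j == 0) then Complex (n 0 0 / 2) (n 0 1 / 2)
    else ((w - n 0 2%R) / 2)%:C).

Lemma sum3 (V : nmodType) (F : 'I_3 -> V) :
  \sum_i F i = F 0 + F 1 + F 2%R.
Proof.
rewrite !big_ord_recl big_ord0 addr0 addrA.
by congr (_ + F _ + F _); apply: val_inj.
Qed.

Lemma sum2 (V : nmodType) (F : 'I_2 -> V) : \sum_i F i = F 0 + F 1.
Proof.
rewrite !big_ord_recl big_ord0 addr0.
by congr (_ + F _); apply: val_inj.
Qed.

Lemma mx2P (A B : 'M[C]_2) :
  A 0 0 = B 0 0 -> A 0 1 = B 0 1 -> A 1 0 = B 1 0 -> A 1 1 = B 1 1 -> A = B.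
Proof.
move=> h00 h01 h10 h11; apply/matrixP => i j.
have o2 (k : 'I_2) : k = 0 \/ k = 1.
  by case: k => -[|[|//]] h; [left|right]; apply: val_inj.
by case: (o2 i) (o2 j) => -> [->|->].
Qed.

Lemma vec3P (m n : vec) :
  m 0 0 = n 0 0 -> m 0 1 = n 0 1 -> m 0 2%R = n 0 2%R -> m = n.
Proof.
move=> h0 h1 h2; apply/rowP => -[[|[|[|//]]] h].
- by rewrite (_ : Ordinal h = 0) //; apply: val_inj.
- by rewrite (_ : Ordinal h = 1) //; apply: val_inj.
- by rewrite (_ : Ordinal h = 2%R) //; apply: val_inj.
Qed.

Lemma complexP (x y : C) :
  complex.Re x = complex.Re y -> complex.Im x = complex.Im y -> x = y.
Proof. by move=> h1 h2; apply/eqP; rewrite eq_complex h1 h2 !eqxx. Qed.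

Lemma blochD w1 n1 w2 n2 : bloch w1 n1 + bloch w2 n2 = bloch (w1 + w2) (n1 + n2).
Proof. by apply: mx2P; rewrite !mxE /=; apply: complexP => /=; field. Qed.

Lemma blochZ (r w : R) n : r%:C *: bloch w n = bloch (r * w) (r *: n).
Proof. by apply: mx2P; rewrite !mxE /=; apply: complexP => /=; field. Qed.

Lemma blochN w n : - bloch w n = bloch (- w) (- n).
Proof. by apply: mx2P; rewrite !mxE /=; apply: complexP => /=; field. Qed.

Lemma bloch_sum (I : finType) (p w : I -> R) (n : I -> vec) :
  \sum_i (p i)%:C *: bloch (w i) (n i) =
  bloch (\sum_i p i * w i) (\sum_i p i *: n i).
Proof.
rewrite (eq_bigr (fun i => bloch (p i * w i) (p i *: n i))) => [|i _];
  last exact: blochZ.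
elim/big_rec3: _ => [|i a b c _ ->]; last by rewrite blochD.
by apply: mx2P; rewrite !mxE /=; apply: complexP => /=; field.
Qed.

Lemma bloch_inj w1 n1 w2 n2 : bloch w1 n1 = bloch w2 n2 -> w1 = w2 /\ n1 = n2.
Proof.
move=> /matrixP e; have := e 0 0; have := e 0 1; have := e 1 1.
rewrite !mxE /= => -[h1] -[h2 h3] -[h4].
by split; [lra|apply: vec3P; lra].
Qed.

Lemma mxtrace_bloch w n : \tr (bloch w n) = w%:C.
Proof. by rewrite /mxtrace sum2 !mxE /=; apply: complexP => /=; field. Qed.

Lemma blochP (A : 'M[C]_2) : dag A = A -> exists w n, A = bloch w n.
Proof.
move=> /matrixP hA; have := hA 0 0; have := hA 0 1; have := hA 1 1.
rewrite !mxE; case e11 : (A 1 1) => [a b]; case e00 : (A 0 0) => [c d].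
case e10 : (A 1 0) => [x y]; case e01 : (A 0 1) => [x' y'] /=.
move=> -[h1] -[h2 h3] -[h4].
exists (a + c), (\row_i if i == 0 then 2 * x else if i == 1 then 2 * y else c - a).
apply: mx2P; rewrite ?e00 ?e01 ?e10 ?e11 !mxE /=; apply: complexP => /=; lra.
Qed.

(** The half-angle formula for a pure state, in algebraic form: [s] is the cosine of half the polar
    angle and [u = 1 / (2 s)]. *)
Lemma bloch_sphere (n : vec) : sqn n = 1 ->
  exists psi : 'cV[C]_2, unit_vec psi /\ proj psi = bloch 1 n.
Proof.
rewrite /sqn sum3; set x : R := n 0 0; set y : R := n 0 1;
  set z : R := n 0 2%R => e.
(* At the south pole [s] would be zero; there the state is the second basis vector. *)
have [z1|z1] := eqVneq z (-1).
  have x0 : x = 0 by nra.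
  have y0 : y = 0 by nra.
  exists (\col_i if i == 0 then 0 else 1).
  split; first by rewrite /unit_vec !mxE sum2 !mxE /= -/x;
    apply: complexP => /=; ring.
  by apply: mx2P; rewrite /proj /ket_bra !mxE big_ord1 !mxE /= -/x -/y -/z;
    apply: complexP => /=; rewrite ?z1 ?x0 ?y0; field.
have zp : 0 < (1 + z) / 2.
  have : -1 <= z by nra.
  by rewrite le_eqVlt eq_sym (negbTE z1) /= => h; lra.
have [s sp s2] : exists2 s : R, 0 < s & s * s = (1 + z) / 2.
  by exists (Num.sqrt ((1 + z) / 2)); rewrite ?sqrtr_gt0 // -expr2 sqr_sqrtr // ltW.
have [u us] : exists u : R, u * s = 2^-1.
  by exists (2 * s)^-1; field; rewrite gt_eqF.
have us' : s * u = 2^-1 by rewrite mulrC.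
have uu : u * u * (1 + z) = 2^-1.
  have -> : u * u * (1 + z) = 2 * (u * s) * (u * s).
    by rewrite (_ : 1 + z = 2 * (s * s)); [ring|rewrite s2; field].
  by rewrite us; field.
exists (\col_i if i == 0 then s%:C else Complex (x * u) (y * u)).
have xy : x ^+ 2 + y ^+ 2 = (1 + z) * (1 - z) by nra.
have n1 : x * u * (x * u) + y * u * (y * u) = (1 - z) / 2.
  have -> : x * u * (x * u) + y * u * (y * u) = (x ^+ 2 + y ^+ 2) * (u * u) by ring.
  rewrite xy (_ : _ * (u * u) = (u * u * (1 + z)) * (1 - z)); last by ring.
  by rewrite uu; field.
split.
  by rewrite /unit_vec !mxE sum2 !mxE /=; apply: complexP => /=; lra.
apply: mx2P; rewrite /proj /ket_bra !mxE big_ord1 !mxE /= -/x -/y -/z;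
  apply: complexP => /=; nra.
Qed.

Lemma qform_bloch w n (v : 'cV[C]_2) a b c d :
  v 0 0 = Complex a b -> v 1 0 = Complex c d ->
  qform (bloch w n) v =
  (((w + n 0 2%R) * (a ^+ 2 + b ^+ 2) + (w - n 0 2%R) * (c ^+ 2 + d ^+ 2)
   + 2 * n 0 0 * (a * c + b * d) + 2 * n 0 1 * (a * d - b * c)) / 2)%:C.
Proof.
move=> h0 h1; rewrite /qform !mxE sum2 !mxE !sum2 !mxE /= h0 h1 /=.
by apply: complexP => /=; field.
Qed.

(** The eigenvalues are [(w - |n|) / 2] and [(w + |n|) / 2]. Instead of diagonalizing, one direction
    evaluates the form at test vectors and the other uses Cauchy-Schwarz. *)
Lemma psd_bloch w n : psd (bloch w n) <-> 0 <= w /\ sqn n <= w ^+ 2.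
Proof.
have hb : dag (bloch w n) = bloch w n.
  by apply: mx2P; rewrite !mxE /=; apply: complexP => /=; field.
rewrite /sqn sum3.
split=> [[_ h]|[w0 h]].
  have Q a b c d : 0 <= (w + n 0 2%R) * (a ^+ 2 + b ^+ 2)
    + (w - n 0 2%R) * (c ^+ 2 + d ^+ 2)
   + 2 * n 0 0 * (a * c + b * d) + 2 * n 0 1 * (a * d - b * c).
    pose v : 'cV[C]_2 := \col_i if i == 0 then Complex a b else Complex c d.
    have := h v; rewrite -/(qform _ v) (@qform_bloch w n v a b c d) ?mxE //.
    by rewrite ler0c; lra.
  move: Q; move: (n 0 0) (n 0 1) (n 0 2%R) => x y z Q.
  (* The basis vectors give [w + z >= 0] and [w - z >= 0]. The next two vectors are, up to sign, the
     columns of the adjugate; they give [(w + z) D] and [(w - z) D] with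
     [D = w^2 - x^2 - y^2 - z^2], whose sum is [2 w D]. *)
  have q1 := Q 1 0 0 0; have q2 := Q 0 0 1 0.
  have q3 := Q x (- y) (- (w + z)) 0; have q4 := Q (- (w - z)) 0 x y.
  have w0 : 0 <= w by lra.
  split=> //; have [wz|] := eqVneq (w * w) 0; last first.
    move=> wn0.
    have wp : 0 < w by rewrite lt_def w0 andbT; apply: contraNneq wn0 => ->;
      rewrite mul0r.
    have : 0 <= w * (w ^+ 2 - (x ^+ 2 + y ^+ 2 + z ^+ 2)) by nra.
    by rewrite pmulr_rge0 // subr_ge0.
  have {}wz : w = 0 by nra.
  have {}q1 : z = 0 by rewrite wz in q1 q2; lra.
  (* When [w = z = 0] the form takes the value [-2 (x^2 + y^2)] here, so [x] and [y] vanish. *)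
  have q5 := Q (-1) 0 x y.
  rewrite wz q1 in q5 *; nra.
split=> // v; rewrite -/(qform _ v).
case e0 : (v 0 0) => [a b]; case e1 : (v 1 0) => [c d].
rewrite (qform_bloch _ _ e0 e1) ler0c.
move: (n 0 0) (n 0 1) (n 0 2%R) h => x y z h.
suff : 0 <= (w + z) * (a ^+ 2 + b ^+ 2) + (w - z) * (c ^+ 2 + d ^+ 2)
  + 2 * x * (a * c + b * d) + 2 * y * (a * d - b * c) by lra.
(* [(X, Y, Z)] is the unnormalized Bloch vector of [v]; its length is [W], the squared norm of
   [v]. *)
set X := 2 * (a * c + b * d); set Y := 2 * (a * d - b * c).
set Z := (a ^+ 2 + b ^+ 2) - (c ^+ 2 + d ^+ 2).
set W := (a ^+ 2 + b ^+ 2) + (c ^+ 2 + d ^+ 2).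
have W0 : 0 <= W by rewrite /W; nra.
have eW : X ^+ 2 + Y ^+ 2 + Z ^+ 2 = W ^+ 2 by rewrite /X /Y /Z /W; ring.
have -> : (w + z) * (a ^+ 2 + b ^+ 2) + (w - z) * (c ^+ 2 + d ^+ 2)
  + 2 * x * (a * c + b * d) + 2 * y * (a * d - b * c) =
    w * W + (x * X + y * Y + z * Z) by rewrite /X /Y /Z /W; ring.
move: X Y Z W W0 eW => X Y Z W W0 eW.
have cs : (x * X + y * Y + z * Z) ^+ 2 <= (w * W) ^+ 2.
  have -> : (w * W) ^+ 2 = w ^+ 2 * (X ^+ 2 + Y ^+ 2 + Z ^+ 2) by rewrite eW; ring.
  have c1 : (x * X + y * Y + z * Z) ^+ 2 <=
      (x ^+ 2 + y ^+ 2 + z ^+ 2) * (X ^+ 2 + Y ^+ 2 + Z ^+ 2).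
    rewrite -subr_ge0.
    have -> : (x ^+ 2 + y ^+ 2 + z ^+ 2) * (X ^+ 2 + Y ^+ 2 + Z ^+ 2)
        - (x * X + y * Y + z * Z) ^+ 2 =
        (x * Y - y * X) ^+ 2 + (x * Z - z * X) ^+ 2 + (y * Z - z * Y) ^+ 2 by ring.
    by rewrite !addr_ge0 ?sqr_ge0.
  by apply: le_trans c1 _; rewrite ler_wpM2r // eW sqr_ge0.
have wW : 0 <= w * W by rewrite mulr_ge0.
move: (w * W) (x * X + y * Y + z * Z) wW cs => p e p0 cs.
rewrite leNgt; apply/negP => h1; clear hb; nra.
Qed.

End Bloch.

(** * Stabilizer states as the six vertices of the octahedron *)

Section Stabilizer.
Variable R : realType.
Local Notation C := R[i].
Local Notation vec := 'rV[R]_3.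

Definition vertex (v : bool * 'I_3) : vec := (-1) ^+ v.1 *: delta_mx 0 v.2.

Definition pauli (i : 'I_3) : 'M[C]_2 :=
  if i == 0 then pauliX R else if i == 1 then pauliY R else pauliZ R.

Lemma l1D (m n : vec) : l1 (m + n) <= l1 m + l1 n.
Proof. by rewrite /l1 -big_split; apply: ler_sum => i _; rewrite mxE ler_normD. Qed.

Lemma l1Z (r : R) (n : vec) : l1 (r *: n) = `|r| * l1 n.
Proof. by rewrite /l1 mulr_sumr; apply: eq_bigr => i _; rewrite mxE normrM. Qed.

Lemma l1_sum (I : finType) (p : I -> R) (n : I -> vec) :
  (forall i, 0 <= p i) -> l1 (\sum_i p i *: n i) <= \sum_i p i * l1 (n i).
Proof.
move=> p0; elim/big_rec2: _ => [|i y1 y2 _ h].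
  by rewrite /l1 big1 // => i _; rewrite mxE normr0.
apply: le_trans (l1D _ _) _.
by rewrite lerD // l1Z ger0_norm.
Qed.

Lemma l1_vertex v : l1 (vertex v) = 1.
Proof.
rewrite /vertex l1Z normrX normrN1 expr1n mul1r /l1 (bigD1 v.2) //= big1 => [|i iv].
  by rewrite mxE !eqxx normr1 addr0.
by rewrite mxE (negbTE iv) andbF normr0.
Qed.

Lemma sqn_vertex v : sqn (vertex v) = 1.
Proof.
rewrite /sqn (bigD1 v.2) //= big1 => [|i iv].
  by rewrite !mxE !eqxx mulr1 addr0 sqrr_sign.
by rewrite !mxE (negbTE iv) andbF mulr0 expr0n.
Qed.

(** The positive and negative parts of each coordinate are placed at the two ends of its axis. The
    slack [l - l1 s] is spread evenly over the six vertices, where it cancels in the vector sum. *)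
Lemma octahedron (l : R) (s : vec) : l1 s <= l ->
  exists q : bool * 'I_3 -> R,
    [/\ forall v, 0 <= q v, \sum_v q v = l & s = \sum_v q v *: vertex v].
Proof.
move=> sl; exists (fun v : bool * 'I_3 =>
  (`|s 0 v.2| + (-1) ^+ v.1 * s 0 v.2) / 2 + (l - l1 s) / 6).
split=> [[b i]||].
- rewrite addr_ge0 ?divr_ge0 ?subr_ge0 //=.
  by case: b; rewrite ?expr0 ?expr1 ?mulN1r ?mul1r; have := ler_norm (s 0 i);
    have := ler_norm (- s 0 i); rewrite normrN; lra.
- rewrite -(pair_big xpredT xpredT (fun (b : bool) i =>
  (`|s 0 i| + (-1) ^+ b * s 0 i) / 2 + (l - l1 s) / 6)) /=.
  by rewrite big_bool /= /l1 !sum3 expr0 expr1; field.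
- rewrite -(pair_big xpredT xpredT (fun (b : bool) i =>
  ((`|s 0 i| + (-1) ^+ b * s 0 i) / 2 + (l - l1 s) / 6) *: vertex (b, i))) /=.
  rewrite big_bool /= -big_split /=; apply/rowP => j.
  rewrite summxE (bigD1 j) //= big1 => [|i ij].
    by rewrite !mxE !eqxx expr0 expr1 /=; field.
  by rewrite !mxE eq_sym (negbTE ij) /= !mulr0 addr0.
Qed.

Lemma pauli_sqr i : pauli i *m pauli i = 1%:M.
Proof.
rewrite /pauli; case: ifP => _; [|case: ifP => _];
 by apply: mx2P; rewrite !mxE sum2 !mxE /=; apply: complexP => /=; ring.
Qed.

Lemma pauli_mem i : pauli i \in [:: 1%:M; pauliX R; pauliY R; pauliZ R].
Proof.
by rewrite /pauli; case: ifP => _; [|case: ifP => _]; rewrite !inE eqxx ?orbT.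
Qed.

Lemma pauli_cases Q : Q \in [:: 1%:M; pauliX R; pauliY R; pauliZ R] ->
  Q = 1%:M \/ exists i, Q = pauli i.
Proof.
rewrite !inE => /or4P[]/eqP ->; first by left.
- by right; exists 0.
- by right; exists 1.
- by right; exists 2%R.
Qed.

Lemma bloch_vertex b i :
  bloch 1 (vertex (b, i)) = 2^-1%:C *: (1%:M + (-1) ^+ b *: pauli i).
Proof.
rewrite /pauli /vertex /=; case: b; rewrite ?expr0 ?expr1;
case: i => -[|[|[|//]]] h /=;
by apply: mx2P; rewrite !mxE /=; apply: complexP => /=; field.
Qed.

(** Comparing entries gives a linear system that determines [n]. Working with the projector keeps
    the global phase of the state out of the computation. *)
Lemma pauli_eigen_bloch (b : bool) i n :
  (-1) ^+ b *: (pauli i *m bloch 1 n) = bloch 1 n -> n = vertex (b, i).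
Proof.
move=> /matrixP e.
have := e 0 0; have := e 0 1; have := e 1 0; have := e 1 1.
rewrite /pauli /vertex /=; case: b e => e; rewrite ?expr0 ?expr1;
case: i e => -[|[|[|//]]] h e /=;
rewrite !mxE !sum2 !mxE /= {e} => -[h1 h2] [h3 h4] [h5 h6] [h7 h8];
by apply: vec3P; rewrite !mxE /=; lra.
Qed.

Lemma proj_ket (psi : 'cV[C]_2) : unit_vec psi -> proj psi *m psi = psi.
Proof.
rewrite /unit_vec => u; rewrite /proj /ket_bra -mulmxA.
by rewrite [dag psi *m psi]mx11_scalar u mulmx1.
Qed.

Lemma proj_bloch (psi : 'cV[C]_2) : unit_vec psi ->
  exists n, sqn n = 1 /\ proj psi = bloch 1 n.
Proof.
move=> u; have hP : dag (proj psi) = proj psi by rewrite dag_ket_bra.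
have [w [n e]] := blochP hP.
have w1 : w = 1.
  apply: complexI; rewrite -(mxtrace_bloch w n) -e /proj /ket_bra mxtrace_mulC.
  by rewrite [dag psi *m psi]mx11_scalar u mxtrace1.
subst w; exists n; split=> //.
have /psd_bloch [_ ] : psd (bloch 1 n) by rewrite -e; exact: psd_proj.
rewrite expr1n => n1; apply/eqP; rewrite eq_le n1 /=.
(* Adding the diagonal entries of this identity gives [(1 + |n|^2) / 2 = 1]. *)
have : proj psi *m proj psi = proj psi.
  by rewrite {2 3}/proj /ket_bra mulmxA proj_ket.
rewrite e => /matrixP h; have := h 0 0; have := h 1 1.
rewrite /sqn sum3 !mxE !sum2 !mxE /= => -[h1 _] [h2 _].
lra.
Qed.

Lemma unit_vec_scale_eq (c : C) (psi : 'cV[C]_2) :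
  unit_vec psi -> c *: psi = psi -> c = 1.
Proof.
rewrite /unit_vec => u e.
by move: (u); rewrite -{2}e -scalemxAr mxE u mulr1.
Qed.

Lemma bloch1_0 : bloch 2 0 = 1%:M :> 'M[C]_2.
Proof. by apply: mx2P; rewrite !mxE /=; apply: complexP => /=; field. Qed.

Lemma pauli_neq_scalar (b : bool) i : 1%:M != (-1) ^+ b *: pauli i.
Proof.
apply/eqP => e; have := bloch_vertex b i; rewrite -e -bloch1_0 blochD blochZ.
by move=> /bloch_inj[+ _]; lra.
Qed.

Lemma bloch_vertex_ket b i (psi : 'cV[C]_2) :
  unit_vec psi -> proj psi = bloch 1 (vertex (b, i)) ->
  (-1) ^+ b *: pauli i *m psi = psi.
Proof.
move=> u e; have := proj_ket u; rewrite e bloch_vertex => h.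
have {}h : psi + (-1) ^+ b *: pauli i *m psi = psi + psi.
  rewrite -{3 4}h -!scalemxAl mulmxDl mul1mx -scalerDl.
  have -> : 2^-1%:C + 2^-1%:C = 1 :> C by apply: complexP => /=; field.
  by rewrite scale1r scalemxAl.
exact: addrI h.
Qed.

Lemma vertex_stab v :
  exists psi : 'cV[C]_2, stab_state psi /\ proj psi = bloch 1 (vertex v).
Proof.
have [psi [u e]] := bloch_sphere (sqn_vertex v).
exists psi; split=> //; split=> //; case: v e => b i e.
pose P := (-1) ^+ b *: pauli i.
have PP : P *m P = 1%:M.
  rewrite /P -scalemxAl -scalemxAr scalerA pauli_sqr -expr2 sqrr_sign.
  by rewrite scale1r.
exists 1%:M, P; split.
- split; first by exists 0%N, 1%:M; rewrite expr0 scale1r inE eqxx.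
  (* The sign is a power of the imaginary unit: [i ^ (2 b) = (-1) ^ b]. *)
  exists (b.*2)%N, (pauli i); split; first exact: pauli_mem.
  by rewrite -mul2n exprM sqr_i.
- exact: pauli_neq_scalar.
- move=> A B; rewrite !inE => /orP[]/eqP-> /orP[]/eqP->;
    by rewrite ?mul1mx ?mulmx1 ?PP !eqxx ?orbT.
- by rewrite mul1mx mulmx1.
- by split; [rewrite mul1mx|exact: bloch_vertex_ket].
Qed.

Lemma stab_vertex (psi : 'cV[C]_2) : stab_state psi ->
  exists v, proj psi = bloch 1 (vertex v).
Proof.
move=> [u [P1 [P2 [[[k1 [Q1 [m1 e1]]] [k2 [Q2 [m2 e2]]]] ne _ _ [f1 f2]]]]].
have [c [i f]] : exists c i, c *: pauli i *m psi = psi.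
  (* A multiple of the identity that fixes a unit vector is the identity, so of two distinct
     stabilizing elements at least one is a multiple of some [pauli i]. *)
  have triv (k : nat) P Q : P = iC R ^+ k *: Q -> P *m psi = psi -> Q = 1%:M ->
      P = 1%:M.
    move=> -> + Q1'; rewrite Q1' -scalemxAl mul1mx => /(unit_vec_scale_eq u) ->.
    by rewrite scale1r.
  have [q1|[i q1]] := pauli_cases m1; last by exists (iC R ^+ k1), i;
    rewrite -q1 -e1.
  have [q2|[i q2]] := pauli_cases m2; last by exists (iC R ^+ k2), i;
    rewrite -q2 -e2.
  by move: ne; rewrite (triv _ _ _ e1 f1 q1) (triv _ _ _ e2 f2 q2) eqxx.
(* Applying [c *: pauli i] twice multiplies [psi] by [c ^+ 2], so the phase is a sign. *)
have /eqP : c ^+ 2 = 1.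
  apply: (unit_vec_scale_eq u); rewrite -{2}f -{2}f mulmxA -scalemxAl -scalemxAr.
  by rewrite pauli_sqr scalerA -scalemxAl mul1mx.
rewrite sqrf_eq1 => c1.
have [n [_ e]] := proj_bloch u.
have [b cb] : exists b : bool, c = (-1) ^+ b.
  by case/orP: c1 => /eqP ->; [exists false|exists true].
exists (b, i); rewrite e; congr (bloch 1 _).
apply: pauli_eigen_bloch; rewrite -e -cb /proj /ket_bra mulmxA scalemxAl.
by rewrite scalemxAl f.
Qed.

End Stabilizer.

(** * Convex geometry of the unit ball, and existence of a least feasible value *)

Section Geometry.
Variable R : realType.
Local Notation vec := 'rV[R]_3.

Lemma sum_enum_val (V : nmodType) (I : finType) (F : I -> V) :
  \sum_i F i = \sum_(j < #|I|) F (enum_val j).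
Proof. by rewrite (reindex (@enum_val I I)) //; apply: onW_bij;
  exact: enum_val_bij. Qed.

Definition conv (S : vec -> Prop) (a : vec) : Prop :=
  exists k (p : 'I_k -> R) (v : 'I_k -> vec),
    [/\ forall j, 0 <= p j, \sum_j p j = 1, forall j, S (v j)
      & a = \sum_j p j *: v j].

Lemma conv_base (S : vec -> Prop) a : S a -> conv S a.
Proof.
move=> Sa; exists 1%N, (fun=> 1), (fun=> a).
by split=> //; rewrite big_ord1 ?scale1r.
Qed.

Lemma conv_cons (S : vec -> Prop) u a b : 0 <= u <= 1 ->
  S a -> conv S b -> conv S (u *: a + (1 - u) *: b).
Proof.
move=> /andP[u0 u1] Sa [k [p [v [p0 p1 Sv ->]]]].
exists k.+1, (fun j => oapp (fun i => (1 - u) * p i) u (unlift ord0 j)).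
exists (fun j => oapp v a (unlift ord0 j)); split.
- by move=> j; case: (unliftP ord0 j) => [i|] _ //=; rewrite mulr_ge0 ?subr_ge0.
- rewrite big_ord_recl unlift_none /=.
  under eq_bigr do rewrite liftK /=.
  by rewrite -mulr_sumr p1 mulr1 addrC subrK.
- by move=> j; case: (unliftP ord0 j) => [i|] _ /=.
- rewrite big_ord_recl unlift_none /= scaler_sumr; congr (_ + _).
  by apply: eq_bigr => i _; rewrite liftK /= scalerA.
Qed.

(** Along the segment, [sqn] is a quadratic polynomial in [t], so the intermediate value theorem for
    polynomials applies. *)
Lemma sphere_crossing (a v : vec) : sqn a <= 1 <= sqn v ->
  exists t, 0 <= t <= 1 /\ sqn ((1 - t) *: a + t *: v) = 1.
Proof.
move=> /andP[a1 v1].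
pose D := \sum_i a 0 i * v 0 i.
have e t : sqn ((1 - t) *: a + t *: v) =
    (1 - t) ^+ 2 * sqn a + 2 * t * (1 - t) * D + t ^+ 2 * sqn v.
  rewrite /sqn /D !mulr_sumr -!big_split /=; apply: eq_bigr => i _.
  by rewrite !mxE; ring.
pose f : {poly R} := (1 - 'X) ^+ 2 * (sqn a)%:P + 2%:P * 'X * (1 - 'X) * D%:P
                     + 'X ^+ 2 * (sqn v)%:P - 1.
have fE t : f.[t] = sqn ((1 - t) *: a + t *: v) - 1.
  by rewrite e /f !hornerE.
have [||t] := @poly_ivt R f 0 1; first exact: ler01.
  rewrite !fE !e; apply/andP; split; lra.
by move=> t01 /rootP; rewrite fE => /eqP; rewrite subr_eq0 => /eqP; exists t.
Qed.

Lemma segment_mix (x y : vec) (m m' p : R) : m' <= p <= m ->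
  exists u, 0 <= u <= 1 /\
    p *: x + (1 - p) *: y =
    u *: (m *: x + (1 - m) *: y) + (1 - u) *: (m' *: x + (1 - m') *: y).
Proof.
move=> /andP[mp pm]; have [mm|mm] := eqVneq m m'.
  have <- : p = m by lra.
  by exists 1; rewrite ler01 lexx scale1r subrr scale0r addr0.
have dp : 0 < m - m' by rewrite subr_gt0 lt_def mm (le_trans mp).
exists ((p - m') / (m - m')); split.
  apply/andP; split; first by apply: divr_ge0; [rewrite subr_ge0|exact: ltW].
  by rewrite ler_pdivrMr // mul1r; lra.
apply/rowP => i; rewrite !mxE; field; lra.
Qed.

(* The extreme points of a polytope intersected with the ball lie on the sphere
   when no vertex of the polytope is interior to the ball. *)
Lemma conv_on_sphere (K : vec -> Prop) :
  (forall t a b, 0 <= t <= 1 -> K a -> K b -> K (t *: a + (1 - t) *: b)) ->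
  forall k (p : 'I_k -> R) (v : 'I_k -> vec),
  (forall j, 0 <= p j) -> \sum_j p j = 1 ->
  (forall j, K (v j)) -> (forall j, 1 <= sqn (v j)) ->
  K (\sum_j p j *: v j) /\
  (sqn (\sum_j p j *: v j) <= 1 ->
   conv (fun a => sqn a = 1 /\ K a) (\sum_j p j *: v j)).
Proof.
move=> convK; elim=> [|k IH] p v p0 p1 Kv v1.
  by move: p1; rewrite big_ord0 => /eqP; rewrite eq_sym oner_eq0.
move: p1; rewrite !big_ord_recl; set q := p ord0; set x := v ord0.
set P := \sum_(i < k) p (lift ord0 i) => qP.
have q0 : 0 <= q := p0 _.
have P0 : 0 <= P by apply: sumr_ge0.
have [Pz|Pz] := eqVneq P 0.
  have -> : \sum_(i < k) p (lift ord0 i) *: v (lift ord0 i) = 0.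
    apply: big1 => i _; suff -> : p (lift ord0 i) = 0 by rewrite scale0r.
    by apply/eqP; move/eqP: Pz; rewrite psumr_eq0 // => /allP; apply;
      rewrite mem_index_enum.
  have -> : q = 1 by lra.
  rewrite scale1r addr0; split=> [|x1]; first exact: Kv.
  apply: conv_base; split; last exact: Kv.
  by apply/eqP; rewrite eq_le x1 v1.
have Pp : 0 < P by rewrite lt_def Pz.
(* The tail is renormalized so that the induction hypothesis applies; the given point then lies on
   the segment from [x] to [b]. *)
pose b := \sum_(i < k) (p (lift ord0 i) / P) *: v (lift ord0 i).
have -> : \sum_(i < k) p (lift ord0 i) *: v (lift ord0 i) = (1 - q) *: b.
  rewrite scaler_sumr; apply: eq_bigr => i _; rewrite scalerA; congr (_ *: _).
  by rewrite (_ : 1 - q = P); [field|lra].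
have [Kb cb] : K b /\ (sqn b <= 1 -> conv (fun a => sqn a = 1 /\ K a) b).
  apply: IH => // [j|]; first by rewrite divr_ge0.
  by rewrite -mulr_suml divff.
have q1 : q <= 1 by lra.
have Ka : K (q *: x + (1 - q) *: b) by apply: convK; [rewrite q0|exact: Kv|].
split=> // a1.
have [t [/andP[t0 t1] c1]] := @sphere_crossing _ x (introT andP (conj a1
  (v1 ord0))).
(* The parameter, on the segment between [x] and [b], of the crossing found towards [x]. *)
pose m := q + t * (1 - q).
have cE : (1 - t) *: (q *: x + (1 - q) *: b) + t *: x = m *: x + (1 - m) *: b.
  by apply/rowP => i; rewrite !mxE /m; ring.
have m01 : 0 <= m <= 1 by rewrite /m; apply/andP; split; nra.
have qm : q <= m by rewrite /m; nra.
have Kx z : 0 <= z <= 1 -> K (z *: x + (1 - z) *: b) by move=> ?;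
  apply: convK => //; exact: Kv.
(* On the side of [b]: if [b] lies in the ball, the induction hypothesis already decomposes it;
   otherwise the segment crosses the sphere a second time. *)
have [m' [m'q m'0 cm']] : exists m', [/\ m' <= q, 0 <= m' &
    conv (fun a => sqn a = 1 /\ K a) (m' *: x + (1 - m') *: b)].
  have [b1|b1] := leP (sqn b) 1.
    by exists 0; rewrite q0 lexx scale0r add0r subr0 scale1r; split=> //; apply: cb.
  have [t' [/andP[t'0 t'1] c'1]] := @sphere_crossing _ b (introT andP (conj a1
    (ltW b1))).
  have eq' : (1 - t') *: (q *: x + (1 - q) *: b) + t' *: b =
             ((1 - t') * q) *: x + (1 - (1 - t') * q) *: b.
    by apply/rowP => i; rewrite !mxE; ring.
  rewrite eq' in c'1; exists ((1 - t') * q); split; [nra|nra|].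
  apply: conv_base; split=> //; apply: Kx; apply/andP; split; nra.
have [u [u01 ->]] := @segment_mix x b m m' q (introT andP (conj m'q qm)).
apply: conv_cons => //; split; [by rewrite -cE|exact: Kx].
Qed.

Lemma sqn_ge_coord (n : vec) i : n 0 i ^+ 2 <= sqn n.
Proof. by rewrite /sqn (bigD1 i) //= lerDl sumr_ge0 // => j _; rewrite sqr_ge0. Qed.

(* With d = n - s, the points l *: vertex v + d span a polytope containing n,
   and none of them is interior to the unit ball since |d| <= l - 1. *)
Lemma conv_feasible (l : R) (n s : vec) :
  1 <= l -> sqn n <= 1 -> l1 s <= l -> sqn (s - n) <= (l - 1) ^+ 2 ->
  conv (fun a => sqn a = 1 /\ l1 (a - (n - s)) <= l) n.
Proof.
move=> l1' n1 sl sn; set d := n - s.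
have lp : 0 < l by lra.
have [q [q0 q1 sE]] := octahedron sl.
pose K a := l1 (a - d) <= l.
have convK t a b : 0 <= t <= 1 -> K a -> K b -> K (t *: a + (1 - t) *: b).
  move=> /andP[t0 t1] Ka Kb; rewrite /K.
  have -> : t *: a + (1 - t) *: b - d = t *: (a - d) + (1 - t) *: (b - d).
    by apply/rowP => i; rewrite !mxE; ring.
  apply: le_trans (l1D _ _) _; rewrite !l1Z !ger0_norm ?subr_ge0 //.
  by rewrite /K in Ka Kb; nra.
pose v := fun j : 'I_#|{: bool * 'I_3}| => l *: vertex R (enum_val j) + d.
have nE : n = \sum_j (q (enum_val j) / l) *: v j.
  rewrite /v -(sum_enum_val (fun w => (q w / l) *: (l *: vertex R w + d))).
  under eq_bigr do rewrite scalerDr scalerA divfK ?gt_eqF //.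
  by rewrite big_split /= -sE -scaler_suml -mulr_suml q1 divff ?gt_eqF //
    scale1r /d addrC subrK.
rewrite [X in conv _ X]nE; apply (@conv_on_sphere K convK) => [j||j|j|].
- by rewrite divr_ge0 // ltW.
- by rewrite -(sum_enum_val (fun w => q w / l)) -mulr_suml q1 divff ?gt_eqF.
- by rewrite /K /v addrK l1Z l1_vertex mulr1 ger0_norm // ltW.
- rewrite /v; case: (enum_val j) => b i.
  have di : d 0 i ^+ 2 <= (l - 1) ^+ 2.
    apply: le_trans sn; apply: le_trans (sqn_ge_coord _ i).
    by rewrite /d !mxE -sqrrN opprB.
  (* The coordinate along the axis of the vertex suffices: it is [l] or [-l] shifted by at most
     [l - 1], so its absolute value is at least 1. *)
  apply: le_trans (sqn_ge_coord _ i).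
  have -> : (l *: vertex R (b, i) + d) 0 i = l * (-1) ^+ b + d 0 i.
    by rewrite mxE; congr (_ + _); rewrite !mxE !eqxx mulr1.
  move: (d 0 i) di => e di.
  have : `|e| <= l - 1 by rewrite -(@ler_pXn2r _ 2) ?nnegrE ?subr_ge0 //
    real_normK ?num_real.
  rewrite ler_norml => /andP[h1 h2].
  by case: b; rewrite ?expr0 ?expr1; nra.
- by rewrite -nE.
Qed.

(* Stated over an abstract domain because unification unfolds the
   neighbourhoods of row vectors. *)
Lemma gauge_continuous (T : topologicalType) (x y z : T -> R) (a b c : R) :
  continuous x -> continuous y -> continuous z ->
  continuous (fun t => Num.max (`|x t| + `|y t| + `|z t|)
    (1 + Num.sqrt ((x t - a) ^+ 2 + (y t - b) ^+ 2 + (z t - c) ^+ 2))).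
Proof.
have normc (f : T -> R) : continuous f -> continuous (fun t => `|f t|).
  by move=> cf t; apply: cvg_norm; exact: cf.
have sqrc (f : T -> R) e : continuous f -> continuous (fun t => (f t - e) ^+ 2).
  by move=> cf t; apply: cvgM; (apply: cvgB; [exact: cf|exact: cvg_cst]).
move=> cx cy cz t.
apply: (@continuous_max _ _ (fun t => `|x t| + `|y t| + `|z t|)
  (fun t => 1 + Num.sqrt ((x t - a) ^+ 2 + (y t - b) ^+ 2 + (z t - c) ^+ 2))).
  by apply: cvgD; [apply: cvgD|]; exact: normc.
apply: cvgD; first exact: cvg_cst.
apply: (@cvg_comp _ _ _ (fun t =>
  (x t - a) ^+ 2 + (y t - b) ^+ 2 + (z t - c) ^+ 2) Num.sqrt).
  by apply: cvgD; [apply: cvgD|]; exact: sqrc.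
exact: sqrt_continuous.
Qed.

(** For fixed [s] the least admissible [l] is the maximum of [l1 s] and [1 + |s - n|]. This is
    continuous in [s] and attains its minimum on a compact cube. *)
Lemma feasible_attained (n : vec) : sqn n <= 1 ->
  exists l, (exists s, [/\ 1 <= l, l1 s <= l & sqn (s - n) <= (l - 1) ^+ 2]) /\
    forall l' s', 1 <= l' -> l1 s' <= l' -> sqn (s' - n) <= (l' - 1) ^+ 2 ->
      l <= l'.
Proof.
move=> n1.
pose F (s : vec) : R := Num.max (l1 s) (1 + Num.sqrt (sqn (s - n))).
have Fle s l : F s <= l <-> [/\ 1 <= l, l1 s <= l & sqn (s - n) <= (l - 1) ^+ 2].
  rewrite /F ge_max; split=> [/andP[-> h]|[h1 -> h2]] /=.
    have s0 := sqrtr_ge0 (sqn (s - n)); split=> //; first by lra.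
    rewrite -[leLHS]sqr_sqrtr ?sumr_ge0 // => [|i _]; last exact: sqr_ge0.
    by rewrite ler_pXn2r ?nnegrE //; lra.
  rewrite addrC -lerBrDr -(@ler_pXn2r _ 2) ?nnegrE ?subr_ge0 ?sqrtr_ge0 //.
  by rewrite sqr_sqrtr // sumr_ge0 // => i _; exact: sqr_ge0.
have Fcont : continuous F.
  have -> : F = fun s : vec => Num.max (`|s 0 0| + `|s 0 1| + `|s 0 2%R|)
      (1 + Num.sqrt ((s 0 0 - n 0 0) ^+ 2 + (s 0 1 - n 0 1) ^+ 2 +
                     (s 0 2%R - n 0 2%R) ^+ 2)).
    by apply: funext => s; rewrite /F /l1 /sqn !sum3 !mxE.
  by apply: gauge_continuous; exact: coord_continuous.
(* The bound 3 works because [F n <= 3]: points outside the cube have [l1 s > 3], so they cannot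
   improve on [n]. *)
pose A := [set s : vec | forall i, `[-3, 3]%classic (s ord0 i)].
have memA s : l1 s <= 3 -> s \in A.
  move=> s3; rewrite inE => i /=; rewrite in_itv /= -ler_norml.
  apply: le_trans s3; rewrite /l1 (bigD1 i) //= lerDl sumr_ge0 //.
have l1n : l1 n <= 3.
  have h i : `|n 0 i| <= 1.
    rewrite -(@ler_pXn2r _ 2) ?nnegrE // real_normK ?num_real // expr1n.
    exact: le_trans (sqn_ge_coord _ i) n1.
  by rewrite /l1 sum3; have := h 0; have := h 1; have := h 2%R; lra.
have Fn : F n <= 3.
  by apply/Fle; split=> //; [lra|rewrite /sqn big1 => [|i _];
    rewrite ?mxE ?subrr; lra].
have [|||s As smin] := @EVT_min_rV R 3 F A.
- by exists n; have := memA n l1n; rewrite inE.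
- have := @rV_compact R 3 (fun=> `[-3, 3]%classic) (fun=>
  @segment_compact R (-3) 3).
  exact.
- exact: continuous_subspaceT.
exists (F s); split; first by exists s; apply/Fle.
move=> l' s' h1 h2 h3; have Fs' : F s' <= l' by apply/Fle.
have [l3|l3] := leP l' 3.
  by apply: le_trans Fs'; apply: smin; apply: memA; lra.
by apply: le_trans (smin n (memA n l1n)) _; lra.
Qed.

End Geometry.

(** * Feasible values: convexity, dyadic decompositions and superpositions *)

Section Feasibility.
Variable R : realType.
Local Notation C := R[i].
Local Notation vec := 'rV[R]_3.

(** [bloch l s] stands for the product of [l] and a mixed stabilizer state. Keeping the product
    undivided makes the condition jointly convex in [l] and [A]. *)
Definition feasible (l : R) (A : 'M[C]_2) : Prop :=
  exists s : vec, l1 s <= l /\ psd (bloch l s - A).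

Lemma psd_bloch_sub (l : R) (s n : vec) :
  psd (bloch l s - bloch 1 n) <-> 1 <= l /\ sqn (s - n) <= (l - 1) ^+ 2.
Proof.
by rewrite blochN blochD -(subr_ge0 1 l); exact: psd_bloch.
Qed.

(** Scaling by [l] turns one witness into the other. The division is legitimate because positivity
    of the difference, whose trace is [l - 1], forces [l >= 1]. *)
Lemma robustness_feasible (l : R) (n : vec) :
  (exists sigma, mixed_stab sigma /\ psd (l%:C *: sigma - bloch 1 n)) <->
  feasible l (bloch 1 n).
Proof.
split=> [[sigma [[k [p [phi [p0 p1 stab ->]]]] h]]|[s [sl h]]].
  have /fin_all_exists[v ve] j := stab_vertex (stab j).
  have e : \sum_(j < k) (p j)%:C *: proj (phi j) =
    bloch 1 (\sum_j p j *: vertex R (v j)).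
    under eq_bigr do rewrite ve.
    by rewrite bloch_sum; under eq_bigr do rewrite mulr1; rewrite p1.
  rewrite e blochZ mulr1 in h; exists (l *: \sum_j p j *: vertex R (v j));
    split=> //.
  have [l1' _] := (psd_bloch_sub _ _ _).1 h.
  rewrite l1Z ger0_norm ?(le_trans ler01) // ler_piMr ?(le_trans ler01) //.
  apply: le_trans (l1_sum _ p0) _.
  by under eq_bigr do rewrite l1_vertex mulr1; rewrite p1.
have [l1' _] := (psd_bloch_sub _ _ _).1 h.
have lp : 0 < l by apply: lt_le_trans l1'.
have [q [q0 q1 sE]] := octahedron sl.
have /fin_all_exists[phi phiP] v := @vertex_stab R v.
exists (\sum_v (q v / l)%:C *: proj (phi v)); split.
  exists #|{: bool * 'I_3}|, (fun j => q (enum_val j) / l), (fun j =>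
    phi (enum_val j)).
  split.
  - by move=> j; rewrite divr_ge0 // ltW.
  - by rewrite -(sum_enum_val (fun v => q v / l)) -mulr_suml q1 divff ?gt_eqF.
  - by move=> j; case: (phiP (enum_val j)).
  - by rewrite -(sum_enum_val (fun v => (q v / l)%:C *: proj (phi v))).
suff -> : l%:C *: (\sum_v (q v / l)%:C *: proj (phi v)) = bloch l s by [].
under eq_bigr do rewrite (phiP _).2.
rewrite bloch_sum blochZ; congr bloch.
  under eq_bigr do rewrite mulr1.
  by rewrite -mulr_suml q1 mulrC divfK // gt_eqF.
rewrite sE scaler_sumr; apply: eq_bigr => v _.
by rewrite scalerA mulrC divfK // gt_eqF.
Qed.

(** A Hermitian sum equals half the sum of itself and its adjoint, so [psd_dyad] bounds it term by
    term. The witness averages the Bloch vectors of [L j] and [Rv j] with weight [absC (a j)]. *)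
Lemma feasible_dyadic (I : finType) (a : I -> C) (L Rv : I -> 'cV[C]_2) :
  (forall j, stab_state (L j)) -> (forall j, stab_state (Rv j)) ->
  dag (\sum_j a j *: ket_bra (L j) (Rv j)) = \sum_j a j *: ket_bra (L j) (Rv j) ->
  feasible (\sum_j absC (a j)) (\sum_j a j *: ket_bra (L j) (Rv j)).
Proof.
set A := \sum_j _ => sL sR hA.
have /fin_all_exists[x xe] j := stab_vertex (sL j).
have /fin_all_exists[y ye] j := stab_vertex (sR j).
exists (\sum_j absC (a j) *: (2^-1 *: (vertex R (x j) + vertex R (y j)))); split.
  apply: le_trans (l1_sum _ _) _ => [j|]; first exact: absC_ge0.
  apply: ler_sum => j _; rewrite ler_piMr ?absC_ge0 // l1Z.
  have := l1D (vertex R (x j)) (vertex R (y j)); rewrite !l1_vertex.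
  by rewrite ger0_norm ?invr_ge0 // ler_pdivrMl // mulr1.
have -> : bloch (\sum_j absC (a j))
    (\sum_j absC (a j) *: (2^-1 *: (vertex R (x j) + vertex R (y j)))) - A =
    \sum_j (2^-1)%:C *: ((absC (a j))%:C *: (proj (L j) + proj (Rv j))
      - (a j *: ket_bra (L j) (Rv j) + conjc (a j) *: ket_bra (Rv j) (L j))).
  rewrite -scaler_sumr sumrB big_split /=.
  have -> : \sum_j conjc (a j) *: ket_bra (Rv j) (L j) = A.
    by rewrite -hA dag_sum; apply: eq_bigr => j _; rewrite dagZ dag_ket_bra.
  rewrite -/A scalerBr; congr (_ - _).
    have -> : \sum_j absC (a j) = \sum_j absC (a j) * 1.
      by under [RHS]eq_bigr do rewrite mulr1.
    rewrite -bloch_sum scaler_sumr; apply: eq_bigr => j _.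
    rewrite xe ye blochD !blochZ !scalerA [_^-1 * absC _]mulrC; congr bloch.
    by field.
  rewrite scalerDr -scalerDl.
  have -> : (2^-1)%:C + (2^-1)%:C = 1 :> C by apply: complexP => /=; field.
  by rewrite scale1r.
apply: psd_sum => j; apply: psdZ; first by rewrite invr_ge0.
exact: psd_dyad.
Qed.

Lemma feasible_sum (I : finType) (p l : I -> R) (A : I -> 'M[C]_2) :
  (forall j, 0 <= p j) -> (forall j, feasible (l j) (A j)) ->
  feasible (\sum_j p j * l j) (\sum_j (p j)%:C *: A j).
Proof.
move=> p0 /fin_all_exists[s sP]; exists (\sum_j p j *: s j); split.
  apply: le_trans (l1_sum _ p0) _; apply: ler_sum => j _.
  by rewrite ler_wpM2l //; case: (sP j).
rewrite -bloch_sum -sumrB; apply: psd_sum => j.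
by rewrite -scalerBr; apply: psdZ => //; case: (sP j).
Qed.

Lemma proj_superposition (I : finType) (c : I -> C) (phi : I -> 'cV[C]_2) :
  proj (\sum_j c j *: phi j) =
  \sum_(ij : I * I) (c ij.1 * conjc (c ij.2)) *: ket_bra (phi ij.1) (phi ij.2).
Proof.
rewrite /proj /ket_bra dag_sum mulmx_suml.
under eq_bigr do rewrite mulmx_sumr.
rewrite pair_big /=; apply: eq_bigr => -[i j] _ /=.
by rewrite dagZ -scalemxAl -scalemxAr scalerA.
Qed.

(** This accounts for the square in the extent: expanding the projector of a superposition into
    dyads costs the square of the l1 norm. *)
Lemma absC_superposition (I : finType) (c : I -> C) :
  \sum_(ij : I * I) absC (c ij.1 * conjc (c ij.2)) = (\sum_j absC (c j)) ^+ 2.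
Proof.
rewrite expr2 mulr_suml; under [RHS]eq_bigr do rewrite mulr_sumr.
by rewrite pair_big /=; apply: eq_bigr => -[i j] _; rewrite absCM absCJ.
Qed.

Lemma feasible_superposition (I : finType) (c : I -> C) (phi : I -> 'cV[C]_2) :
  (forall j, stab_state (phi j)) ->
  feasible ((\sum_j absC (c j)) ^+ 2) (proj (\sum_j c j *: phi j)).
Proof.
move=> st; rewrite -absC_superposition proj_superposition.
apply: (@feasible_dyadic _ (fun ij => c ij.1 * conjc (c ij.2)) (fun ij => phi ij.1)
  (fun ij => phi ij.2)) => //.
by rewrite -proj_superposition dag_ket_bra.
Qed.

Lemma ket_braE (u v w : 'cV[C]_2) : ket_bra u v *m w = braket v w *: u.
Proof.
by rewrite /ket_bra -mulmxA [dag v *m w]mx11_scalar mul_mx_scalar.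
Qed.

(** On the kernel of [B] the form of the difference is [-|<psi|v>|^2], so [psi] is orthogonal to
    that kernel. As [B] is Hermitian, [psi] lies in its range. *)
Lemma psd_sub_proj_range (B : 'M[C]_2) (psi : 'cV[C]_2) :
  dag B = B -> psd (B - proj psi) -> exists eta, B *m eta = psi.
Proof.
move=> hB [_ h]; suff /submxP[D e] : (psi^T <= B^T)%MS.
  by exists D^T; rewrite -[psi]trmxK e trmx_mul trmxK.
rewrite submxE; set K := cokermx B^T.
(* The columns of [dag K^T] lie in the kernel of [B] and serve as test vectors. *)
have BN : B *m dag K^T = 0.
  rewrite -{1}hB -dagM -[B]trmxK -trmx_mul mulmx_coker.
  by rewrite trmx0 dag0.
have N0 : dag psi *m dag K^T = 0.
  apply/rowP => j; have := h (col j (dag K^T)).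
  rewrite -/(qform _ _) qformD qformN qform_proj /qform -mulmxA.
  rewrite {2}colE (mulmxA B) BN mul0mx mulmx0 [X in X - _]mxE
    add0r oppr_ge0 lecR => h0.
  have /eqP : absC (braket psi (col j (dag K^T))) ^+ 2 = 0.
    by apply/eqP; rewrite eq_le h0 sqr_ge0.
  rewrite sqrf_eq0 => /eqP a0; apply/eqP.
  have -> : (dag psi *m dag K^T) 0 j = braket psi (col j (dag K^T)).
    by rewrite /braket colE mulmxA -colE [RHS]mxE.
  by rewrite mxE -normr_eq0 -absCE a0.
move: N0; rewrite -dagM => /(congr1 (@dag R _ _)); rewrite dagK dag0.
by move=> /(congr1 trmx); rewrite trmx_mul trmxK trmx0 => ->.
Qed.

(* If B eta = psi with B = sum_v q v |phi v><phi v|, then the coefficients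
   q v <phi v|eta> represent psi, and Cauchy-Schwarz bounds their l1 norm by
   (sum q) <eta|B|eta>, where <eta|B|eta> <= 1 because B >= |psi><psi|. *)
Lemma superposition_of_feasible (phi : bool * 'I_3 -> 'cV[C]_2) (l : R) psi :
  (forall v, proj (phi v) = bloch 1 (vertex R v)) -> feasible l (proj psi) ->
  exists c : bool * 'I_3 -> C,
    psi = \sum_v c v *: phi v /\ (\sum_v absC (c v)) ^+ 2 <= l.
Proof.
move=> phiP [s [sl h]]; have [q [q0 q1 sE]] := octahedron sl.
have BE : bloch l s = \sum_v (q v)%:C *: proj (phi v).
  under eq_bigr do rewrite phiP.
  by rewrite bloch_sum -sE; under eq_bigr do rewrite mulr1; rewrite q1.
have hB : dag (bloch l s) = bloch l s.
  by rewrite BE dag_sum; apply: eq_bigr => v _; rewrite dagZ dag_ket_bra conjcR.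
have [eta etaP] := psd_sub_proj_range hB h.
exists (fun v => (q v)%:C * braket (phi v) eta); split.
  rewrite -etaP BE mulmx_suml; apply: eq_bigr => v _.
  by rewrite -scalemxAl /proj ket_braE scalerA.
under eq_bigr do rewrite absCM absC_real //.
apply: le_trans (weighted_cauchy _ q0) _.
set Y := \sum_v q v * _.
have Y0 : 0 <= Y by apply: sumr_ge0 => v _; rewrite mulr_ge0 ?sqr_ge0.
have qY : qform (bloch l s) eta = Y%:C.
  rewrite BE qform_sum rmorph_sum; apply: eq_bigr => v _ /=.
  by rewrite qformZ qform_proj -rmorphM.
have := h.2 eta; rewrite -/(qform _ _) qformD qformN qform_proj qY.
(* Because [B eta = psi], this overlap is [<eta|B|eta>] itself; positivity then reads [Y^2 <= Y],
   whence [Y <= 1]. *)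
have -> : absC (braket psi eta) = Y.
  have -> : braket psi eta = conjc (Y%:C).
    by rewrite -qY /qform -mulmxA etaP -/(braket eta psi) braketJ.
  by rewrite absCJ absC_real.
rewrite subr_ge0 lecR q1 => YY.
have l0 : 0 <= l by rewrite -q1 sumr_ge0.
rewrite ler_piMr //; move: (Y) Y0 YY => y y0 yy.
by rewrite leNgt; apply/negP => y1; clear -y0 yy y1; nra.
Qed.

End Feasibility.

(** * Extents, pure decompositions and equimagicality *)

Section Extent.
Variable R : realType.
Local Notation C := R[i].
Local Notation vec := 'rV[R]_3.

Lemma inf_min (S : set R) x : S x -> (forall y, S y -> x <= y) -> inf S = x.
Proof.
move=> Sx lb; apply/eqP; rewrite eq_le ge_inf //=; last by exists x.
by apply: lb_le_inf; first by exists x.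
Qed.

Lemma robustness_attained (n : vec) : sqn n <= 1 ->
  exists l, feasible l (bloch 1 n) /\ forall l', feasible l' (bloch 1 n) -> l <= l'.
Proof.
move=> /feasible_attained[l [[s [l1' sl sn]] lmin]]; exists l; split.
  by exists s; split=> //; apply/psd_bloch_sub.
by move=> l' [s' [sl' /psd_bloch_sub[l1'' sn']]]; exact: (lmin l' s').
Qed.

Lemma stab_extent (psi : 'cV[C]_2) (l : R) : feasible l (proj psi) ->
  exists k (c : 'I_k -> C) (phi : 'I_k -> 'cV[C]_2),
    [/\ forall j, stab_state (phi j), psi = \sum_j c j *: phi j &
        (\sum_j absC (c j)) ^+ 2 <= l].
Proof.
have /fin_all_exists[phi phiP] v := @vertex_stab R v.
move=> /(superposition_of_feasible (fun v => (phiP v).2))[c [psiE cl]].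
exists #|{: bool * 'I_3}|, (fun j => c (enum_val j)), (fun j => phi (enum_val j)).
split; first by move=> j; case: (phiP (enum_val j)).
  by rewrite -(sum_enum_val (fun v => c v *: phi v)).
by rewrite -(sum_enum_val (fun v => absC (c v))).
Qed.

Lemma extent_le (psi : 'cV[C]_2) (l : R) : feasible l (proj psi) -> extent psi <= l.
Proof.
move=> /stab_extent[k [c [phi [st psiE cl]]]]; apply: le_trans cl.
apply: ge_inf; first by exists 0 => _ [k' [c' [phi' [_ _ ->]]]]; rewrite sqr_ge0.
by exists k, c, phi.
Qed.

(** The witness is the least feasible value: every superposition has a feasible cost, so it bounds
    the infimum from below, whether or not the infimum is attained. *)
Lemma extent_feasible (psi : 'cV[C]_2) : unit_vec psi ->
  exists2 l, feasible l (proj psi) & l <= extent psi.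
Proof.
move=> /proj_bloch[n [n1 e]].
have [l [fl lmin]] : exists l, feasible l (proj psi) /\
    forall l', feasible l' (proj psi) -> l <= l'.
  by rewrite e; apply: robustness_attained; rewrite n1.
exists l => //; apply: lb_le_inf.
  by have [k [c [phi [st psiE _]]]] := stab_extent fl;
    exists ((\sum_j absC (c j)) ^+ 2), k, c, phi.
by move=> _ [k [c [phi [st psiE ->]]]]; apply: lmin; rewrite psiE;
  exact: feasible_superposition.
Qed.

(** Feasible values below the individual extents average to a feasible value of [rho], by
    [feasible_sum]. *)
Lemma pure_decomp_extent (rho : 'M[C]_2) (l : R) k (p : 'I_k -> R) Psi :
  (forall l', feasible l' rho -> l <= l') -> pure_decomp rho p Psi ->
  l <= \sum_j p j * extent (Psi j).
Proof.
move=> lmin [p0 p1 u rhoE].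
have /fin_all_exists2[m fm me] j := extent_feasible (u j).
apply: (@le_trans _ _ (\sum_j p j * m j)).
  by apply: lmin; rewrite rhoE; exact: feasible_sum.
by apply: ler_sum => j _; rewrite ler_wpM2l.
Qed.

Lemma feasible_pure_decomp (n : vec) (l : R) :
  sqn n <= 1 -> feasible l (bloch 1 n) ->
  exists k (p : 'I_k -> R) Psi,
    pure_decomp (bloch 1 n) p Psi /\ forall j, feasible l (proj (Psi j)).
Proof.
move=> n1 [s [sl /psd_bloch_sub[l1' sn]]].
have [k [p [a [p0 p1 aP nE]]]] := conv_feasible l1' n1 sl sn.
have /fin_all_exists[Psi PsiP] j := bloch_sphere (aP j).1.
exists k, p, Psi; split.
  split=> // [j|]; first by case: (PsiP j).
  under eq_bigr do rewrite (PsiP _).2.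
  by rewrite bloch_sum -nE; under eq_bigr do rewrite mulr1; rewrite p1.
(* Translating [s] along with the Bloch vector leaves the difference [s - n] unchanged, so the same
   [l] stays feasible. *)
move=> j; rewrite (PsiP j).2; exists (a j - (n - s)); split; first by case: (aP j).
apply/psd_bloch_sub; split=> //.
by rewrite [_ - a j]addrC addrA addNr add0r opprB.
Qed.

Lemma dyadic_of_pure_decomp (rho : 'M[C]_2) (l : R) k (p : 'I_k -> R) Psi :
  pure_decomp rho p Psi -> (forall j, feasible l (proj (Psi j))) ->
  exists m (a : 'I_m -> C) (L Rv : 'I_m -> 'cV[C]_2),
    [/\ forall j, stab_state (L j), forall j, stab_state (Rv j),
        rho = \sum_j a j *: ket_bra (L j) (Rv j) & \sum_j absC (a j) <= l].
Proof.
move=> [p0 p1 u rhoE] fl.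
have /fin_all_exists[phi phiP] v := @vertex_stab R v.
have /fin_all_exists[c cP] j :=
  superposition_of_feasible (fun v => (phiP v).2) (fl j).
pose V := (bool * 'I_3)%type; pose T := ('I_k * (V * V))%type.
(* One dyad for each component of the decomposition and each pair of vertices; the weights [p] sum
   to 1, so the total cost is at most [l]. *)
pose a (t : T) : C := (p t.1)%:C * (c t.1 t.2.1 * conjc (c t.1 t.2.2)).
exists #|{: T}|, (fun j => a (enum_val j)), (fun j => phi (enum_val j).2.1),
  (fun j => phi (enum_val j).2.2); split.
- by move=> j; exact: (phiP _).1.
- by move=> j; exact: (phiP _).1.
- rewrite -(sum_enum_val (fun t : T => a t *: ket_bra (phi t.2.1) (phi t.2.2))).
  rewrite rhoE -(pair_big xpredT xpredT (fun j (ij : V * V) =>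
    a (j, ij) *: ket_bra (phi ij.1) (phi ij.2))) /=.
  apply: eq_bigr => j _; rewrite (cP j).1 proj_superposition scaler_sumr.
  by apply: eq_bigr => ij _; rewrite scalerA.
rewrite -(sum_enum_val (fun t : T => absC (a t))).
rewrite -(pair_big xpredT xpredT (fun j (ij : V * V) => absC (a (j, ij)))) /=.
rewrite -[leRHS]mul1r -p1 mulr_suml; apply: ler_sum => j _.
apply: le_trans (ler_wpM2l (p0 j) (cP j).2); rewrite -absC_superposition mulr_sumr.
by apply: ler_sum => ij _; rewrite /a absCM absC_real.
Qed.

(** No extent exceeds [l], yet their average is at least [l]; hence every component of nonzero
    weight has extent exactly [l]. *)
Lemma mixed_extent_equimagical (rho : 'M[C]_2) (l : R) k (p : 'I_k -> R) Psi :
  pure_decomp rho p Psi -> (forall j, extent (Psi j) <= l) ->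
  (forall k' (p' : 'I_k' -> R) Psi', pure_decomp rho p' Psi' ->
     l <= \sum_j p' j * extent (Psi' j)) ->
  mixed_extent rho = l /\ equimagical rho.
Proof.
move=> [p0 p1 u rhoE] le lb.
have pl : \sum_j p j * l = l by rewrite -mulr_suml p1 mul1r.
have ext j : p j != 0 -> extent (Psi j) = l.
  move=> pj; apply/eqP; rewrite -subr_eq0 -oppr_eq0 opprB.
  have : \sum_j p j * (l - extent (Psi j)) == 0.
    rewrite eq_le; apply/andP; split; last first.
      by apply: sumr_ge0 => i _; rewrite mulr_ge0 // subr_ge0.
    under eq_bigr do rewrite mulrBr.
    by rewrite sumrB pl subr_le0 lb.
  rewrite psumr_eq0 => [|i _]; last by rewrite mulr_ge0 // subr_ge0.
  by move=> /allP/(_ j (mem_index_enum _)); rewrite mulf_eq0 (negbTE pj).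
have [j0 pj0] : exists j, p j != 0.
  apply/existsP; apply: contraTT isT => /existsPn h.
  by move: p1; rewrite big1 => [/eqP|j _]; [rewrite eq_sym oner_eq0|apply/eqP;
    move: (h j); rewrite negbK].
(* States of weight zero are replaced by one of positive weight. *)
pose Psi' j := if p j == 0 then Psi j0 else Psi j.
have ext' j : extent (Psi' j) = l by rewrite /Psi'; case: eqP => [_|/eqP];
  exact: ext.
have dec : pure_decomp rho p Psi'.
  split=> // [j|]; first by rewrite /Psi'; case: ifP.
  rewrite rhoE; apply: eq_bigr => j _; rewrite /Psi'.
  by case: eqP => // ->; rewrite !scale0r.
have sum' : \sum_j p j * extent (Psi' j) = l by under eq_bigr do rewrite ext'.
have ml : mixed_extent rho = l.
  apply: inf_min; first by exists k, p, Psi'.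
  by move=> _ [k' [p' [Psi'' [d ->]]]]; exact: lb.
split=> //; exists k, p, Psi'; split=> //; last by rewrite ml.
by move=> i j; rewrite !ext'.
Qed.

End Extent.

Theorem theorem2 (R : realType) (rho : 'M[R[i]]_2) :
  density rho ->
  gen_robustness rho = dyadic_negativity rho /\
  dyadic_negativity rho = mixed_extent rho /\
  equimagical rho.
Proof.
move=> [psd_rho tr_rho]; have [w [n rhoE]] := blochP psd_rho.1.
have w1 : w = 1 by apply: complexI; rewrite -(mxtrace_bloch w n) -rhoE.
subst w; have n1 : sqn n <= 1.
  by move: psd_rho; rewrite rhoE => /psd_bloch[_]; rewrite expr1n.
(* The least feasible [l] is the common value of the three quantities. *)
have [l [fl lmin]] := robustness_attained n1.
have [k [p [Psi [dec fPsi]]]] := feasible_pure_decomp n1 fl.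
have genE : gen_robustness rho = l.
  rewrite rhoE; apply: inf_min; first exact/robustness_feasible.
  by move=> y /robustness_feasible; exact: lmin.
have dyadicE : dyadic_negativity rho = l.
  have lb m (a : 'I_m -> R[i]) L Rv : (forall j, stab_state (L j)) ->
      (forall j, stab_state (Rv j)) ->
      bloch 1 n = \sum_j a j *: ket_bra (L j) (Rv j) -> l <= \sum_j absC (a j).
    move=> sL sR e; apply: lmin; rewrite e; apply: feasible_dyadic => //.
    by rewrite -e -rhoE psd_rho.1.
  rewrite rhoE; apply: inf_min; last first.
    by move=> _ [m [a [L [Rv [sL sR e ->]]]]]; exact: lb e.
  have [m [a [L [Rv [sL sR e al]]]]] := dyadic_of_pure_decomp dec fPsi.
  (* The cost is at most [l] by construction and at least [l] by [lb], so the minimum is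
     attained. *)
  exists m, a, L, Rv; split=> //; apply/eqP; rewrite eq_le al andbT.
  exact: lb e.
have [mixE equi] : mixed_extent rho = l /\ equimagical rho.
  rewrite rhoE; apply: mixed_extent_equimagical dec _ _.
    by move=> j; exact: extent_le.
  by move=> k' p' Psi'; exact: pure_decomp_extent.
by rewrite genE dyadicE mixE.
Qed.
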